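(* Let $(X,\perp)$ be a linear orthogonality space of finite rank $m$. Then: (i) If $m=2$, then $X$ is either finite with even cardinality or infinite. (ii) If $m\geq 3$, then $X$ is infinite.
   Context: An orthogonality space is a non-empty set $X$ equipped with a symmetric, irreflexive binary relation $\perp$. The rank of $(X,\perp)$ is the supremum of the cardinalities of sets of mutually orthogonal elements of $X$. For $A\subseteq X$, $A^{\perp}=\{x\in X: x\perp a \text{ for all } a\in A\}$. $(X,\perp)$ is called linear if, for any two distinct elements $e,f\in X$, there is a third element $g\in X$ such that $\{e,f\}^{\perp}=\{e,g\}^{\perp}$ and exactly one of $f$ and $g$ is orthogonal to $e$. *)

(* Defs.v *)
From mathcomp Require Import all_boot.
From mathcomp Require Import boolp classical_sets functions cardinality.

Set Implicit Arguments.
Unset Strict Implicit.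
Unset Printing Implicit Defensive.

Local Open Scope classical_set_scope.
Local Open Scope card_scope.

Record orthogonality_space := OrthogonalitySpace {
  osort :> Type;
  perp : osort -> osort -> Prop;
  osort_nonempty : [set: osort] !=set0;
  perp_sym : forall x y, perp x y -> perp y x;
  perp_irrefl : forall x, ~ perp x x
}.

Notation "x '_|_' y" := (perp x y) (at level 70, no associativity).

Definition mutually_orthogonal (X : orthogonality_space) (A : set X) : Prop :=
  forall x y : X, A x -> A y -> x <> y -> x _|_ y.

(** The supremum of the cardinalities of the mutually orthogonal sets is the
    natural number [m]: [m] is the least [n] bounding all of them.  In
    particular, every mutually orthogonal set is finite. *)
Definition has_rank (X : orthogonality_space) (m : nat) : Prop :=
  (forall A : set X, mutually_orthogonal A -> A #<= `I_m) /\
  (forall n : nat,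
     (forall A : set X, mutually_orthogonal A -> A #<= `I_n) -> (m <= n)%N).

Definition orthocomplement (X : orthogonality_space) (A : set X) : set X :=
  [set x | forall a : X, A a -> x _|_ a].

Definition linear_orthogonality (X : orthogonality_space) : Prop :=
  forall e f : X, e <> f ->
  exists g : X, [/\ g <> e, g <> f,
    orthocomplement [set e; f] = orthocomplement [set e; g] &
    (f _|_ e /\ ~ g _|_ e) \/ (~ f _|_ e /\ g _|_ e)].

(* Main.v *)
Require Import Defs.
From mathcomp Require Import all_boot all_algebra zify.

(** By linearity, any pair of distinct points has the same orthocomplement as
    an orthogonal pair.  In rank 2 this makes orthogonality a perfect matching.
    In rank [m >= 3], the points orthogonal to [m - 3] members of a maximal
    orthogonal family form a linear space of rank 3, in which any two distinct
    points have exactly one common orthogonal point and no point is orthogonal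
    to all others.  A finite graph with these properties would contradict the
    friendship theorem of Erdős, Rényi and Sós: it is regular of some degree
    [d], and modulo a prime dividing [d - 1] its adjacency matrix [A] satisfies
    [A ^ 2 = J], the all-ones matrix.  Then [A - J] squares to zero, so [A] has
    the trace [1] of [J], although its diagonal vanishes. *)

(** * Parity of a finite set carrying a fixed-point-free involution *)

Lemma involution_card_even (T : finType) (s : T -> T) :
  involutive s -> (forall x, s x != x) -> ~~ odd #|T|.
Proof.
move=> sK sN.
have ord2 x : fingraph.order s x = 2.
  apply: (@order_cycle _ s [:: x; s x]); rewrite ?inE ?eqxx //=.
    by rewrite sK !eqxx.
  by rewrite inE eq_sym sN.
(* [fcard s T] counts the orbits, each of which has two elements. *)
have <- : fcard s T * 2 = #|T|.
  apply: fcard_order_set => //; first exact: can_inj sK.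
  by apply/subsetP => x _; rewrite !inE ord2.
by rewrite muln2 odd_double.
Qed.

(** * Traces of square matrices over a field *)

Section Matrices.
Import GRing.Theory.
Local Open Scope ring_scope.

(* In a rank factorisation [B = C *m R], [B *m B = 0] forces [R *m C = 0]. *)
Lemma mxtrace_square_zero (F : fieldType) n (B : 'M[F]_n) :
  B *m B = 0 -> \tr B = 0.
Proof.
move=> BB0; rewrite -[B in LHS]mulmx_base mxtrace_mulC.
suff -> : row_base B *m col_base B = 0 by rewrite mxtrace0.
apply: (row_full_inj (col_base_full B)).
apply: (row_free_inj (row_base_free B)).
by rewrite mulmx0 mul0mx mulmxA mulmx_base -mulmxA mulmx_base.
Qed.

(** As [n] is 1 in [F], [J] is idempotent of trace 1; thus [A - J] squares to
    [J - J - J + J = 0]. *)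
Lemma mxtrace_idempotent_const (F : fieldType) n (A : 'M[F]_n) :
  n%:R = 1 :> F -> A *m A = const_mx 1 ->
  A *m const_mx 1 = const_mx 1 :> 'M[F]_n ->
  const_mx 1 *m A = const_mx 1 :> 'M[F]_n -> \tr A = 1.
Proof.
move=> n1 AA AJ JA; set J := const_mx 1 : 'M[F]_n.
have JJ : J *m J = J.
  apply/matrixP => i j; rewrite !mxE.
  by under eq_bigr do rewrite !mxE mulr1; rewrite sumr_const card_ord.
have : \tr (A - J) = 0.
  apply: mxtrace_square_zero.
  by rewrite mulmxBl !mulmxBr AA AJ JA JJ !subrr.
move/eqP; rewrite raddfB /= subr_eq0 => /eqP ->.
rewrite /mxtrace; under eq_bigr do rewrite mxE.
by rewrite sumr_const card_ord.
Qed.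
End Matrices.

(** * Friendship graphs: regularity and the trace argument *)

Section Friendship.
Variables (n : nat) (e : rel 'I_n).
Hypotheses (e_sym : symmetric e) (e_irr : irreflexive e).
Hypothesis friend : forall x y, x != y -> #|[set z | e x z && e y z]| = 1%N.

Let nbr x := [set z | e x z].

Lemma friend_unique x y z t :
  x != y -> e x z -> e y z -> e x t -> e y t -> z = t.
Proof.
move=> /friend/eqP/cards1P[w Ew] xz yz xt yt.
have : z \in [set w] by rewrite -Ew inE xz yz.
have : t \in [set w] by rewrite -Ew inE xt yt.
by rewrite !inE => /eqP -> /eqP ->.
Qed.

Lemma friend_exists x y : x != y -> exists z, e x z && e y z.
Proof.
move=> /friend/eqP/cards1P[w Ew]; exists w.
by have := set11 w; rewrite -Ew inE.
Qed.

(** Send each neighbour [z] of [x] to the common neighbour of [z] and [y]. Neighbours of [x] with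
    the same image [w] are common neighbours of [x] and [w], hence equal; here [w] is not [x], since
    only [w] is adjacent to [y]. *)
Lemma leq_degree_nonadjacent x y : ~~ e x y -> #|nbr x| <= #|nbr y|.
Proof.
move=> xNy; case: (eqVneq x y) => [-> //|xy].
(* The default [x] is never taken on a neighbour of [x]: such a point differs from [y]. *)
pose h z := odflt x [pick w | e z w && e y w].
have hP z : e x z -> e z (h z) /\ e y (h z).
  move=> xz; rewrite /h; case: pickP => [w /andP[] //|none].
  have zy : z != y by apply: contraNneq xNy => <-.
  by have [w] := friend_exists _ _ zy; have := none w => /= ->.
rewrite -(card_in_imset (f := h) (D := nbr x)).
  apply: subset_leq_card; apply/subsetP => _ /imsetP[z + ->].
  by rewrite !inE => /hP[].
move=> z t; rewrite !inE => xz xt hzt.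
have [zh yh] := hP z xz; have [th _] := hP t xt; rewrite -hzt in th.
apply: (@friend_unique x (h z)) => //; try by rewrite e_sym.
by apply: contraNneq xNy => ->; rewrite e_sym.
Qed.

Lemma degree_nonadjacent x y : ~~ e x y -> #|nbr x| = #|nbr y|.
Proof.
move=> xNy; apply/eqP; rewrite eqn_leq !leq_degree_nonadjacent //.
by rewrite e_sym.
Qed.

Hypothesis no_hub : forall x, exists y, (y != x) && ~~ e x y.

(* Otherwise non-neighbours [u] of [x] and [v] of [y] would yield a
   four-cycle [x, y, u, v]. *)
Lemma degree_constant x y : #|nbr x| = #|nbr y|.
Proof.
apply/eqP/negPn/negP => dxy.
have adj u v : #|nbr u| != #|nbr v| -> e u v.
  by move=> duv; apply/negPn/negP => /degree_nonadjacent/eqP; apply/negP.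
have [u /andP[ux xNu]] := no_hub x; have [v /andP[vy yNv]] := no_hub y.
have du := degree_nonadjacent _ _ xNu; have dv := degree_nonadjacent _ _ yNv.
have xv : e x v by apply: adj; rewrite -dv.
have uv : e u v by apply: adj; rewrite -du -dv.
have uy : e u y by apply: adj; rewrite -du.
have := friend_unique _ _ _ _ ux uv xv uy (adj _ _ dxy).
by move/eqP; apply/negP.
Qed.

(** Count walks of length two from [x]. By middle vertex, regularity gives the left side; by end
    vertex, the degree counts those returning to [x], and one leads to each other vertex. *)
Lemma degree_square x : (#|nbr x| * #|nbr x| = #|nbr x| + n.-1)%N.
Proof.
have cnt (P : pred 'I_n) : #|[set y | P y]| = \sum_y P y.
  by rewrite -sum1dep_card big_mkcond; apply: eq_bigr => i _; case: (P i).
have: \sum_z #|[set y | e x y && e z y]| = (#|nbr x| * #|nbr x|)%N.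
  under eq_bigr do rewrite cnt.
  have nbrE z : #|nbr z| = \sum_y e z y by apply: cnt.
  rewrite exchange_big /= {2}nbrE big_distrr /=.
  apply: eq_bigr => y _; rewrite (degree_constant x y) nbrE big_distrl /=.
  by apply: eq_bigr => z _; rewrite e_sym andbC mulnb (e_sym z) (e_sym y x).
move=> <-; rewrite (bigD1 x) //=; congr (_ + _).
  by apply: eq_card => y; rewrite !inE andbb.
under eq_bigr => z zx do rewrite friend 1?eq_sym //.
by rewrite sum1_card cardC1 card_ord.
Qed.

Lemma degree_small x : #|nbr x| + 2 <= n.
Proof.
have [y /andP[yx xNy]] := no_hub x.
have <- : #|[set x; y]| = 2%N by rewrite cards2 eq_sym yx.
rewrite -[X in _ <= X]card_ord -cardsUI.
rewrite [_ :&: _](_ : _ = set0) ?cards0 ?addn0 ?max_card //.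
apply/setP => z; rewrite !inE; apply/negP => /andP[xz].
by case/orP => /eqP Ez; move: xz; rewrite Ez ?e_irr // (negPf xNy).
Qed.

Lemma hubless_friendship_empty : n = 0%N.
Proof.
case: (posnP n) => // n_gt0; exfalso.
pose x0 := Ordinal n_gt0; pose d := #|nbr x0|.
have dE x : #|nbr x| = d by apply: degree_constant.
have dd : (d * d = d + n.-1)%N := degree_square x0.
have dn : d + 2 <= n := degree_small x0.
(* Here [d * d >= 2 * d + 1]; so [d.-1] exceeds 1 and has a prime divisor. *)
have d3 : 2 < d by nia.
have d1 : 1 < d.-1 by lia.
have [p p_pr [q dq]] : exists2 p, prime p & exists q, d.-1 = (q * p)%N.
  by exists (pdiv d.-1); [apply: pdiv_prime|apply/dvdnP/pdiv_dvd].
have p0 : (p%:R = 0 :> 'F_p)%R by apply: pchar_Fp_0.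
have mod1 r : ((r * p).+1%:R = 1 :> 'F_p)%R.
  by rewrite GRing.mulrSr GRing.natrM p0 GRing.mulr0 GRing.add0r.
have dF : (d%:R = 1 :> 'F_p)%R by rewrite (_ : d = (q * p).+1) ?mod1 //; lia.
(* The degree equation reads [n = d * d.-1 + 1]. *)
have nF : (n%:R = 1 :> 'F_p)%R.
  by rewrite [in LHS](_ : n = (d * q * p).+1) ?mod1 //; nia.
pose A : 'M['F_p]_n := (\matrix_(i, j) (e i j)%:R)%R.
have cnt (P : pred 'I_n) : (\sum_k (P k)%:R = #|[set k | P k]|%:R :> 'F_p)%R.
  rewrite -GRing.natr_sum -sum1dep_card [in RHS]big_mkcond.
  by congr (_%:R)%R; apply: eq_bigr => i _; case: (P i).
(* Entries of [A *m A] count common neighbours: 1 off the diagonal and [d], which is 1 modulo [p],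
   on it. Row and column sums of [A] are also [d]. *)
have : (\tr A = 1)%R.
  apply: mxtrace_idempotent_const => //; apply/matrixP => i j; rewrite !mxE.
  - under eq_bigr do rewrite !mxE (e_sym _ j) -GRing.natrM mulnb.
    rewrite (cnt (fun k => e i k && e j k)).
    case: (eqVneq i j) => [->|/friend -> //].
    rewrite (_ : [set k | e j k && e j k] = nbr j) ?dE //.
    by apply/setP => k; rewrite !inE andbb.
  - under eq_bigr do rewrite !mxE GRing.mulr1.
    by rewrite (cnt (e i)) dE.
  - under eq_bigr do rewrite !mxE GRing.mul1r e_sym.
    by rewrite (cnt (e j)) dE.
rewrite /mxtrace big1 => [/eqP|i _]; last by rewrite mxE e_irr.
by rewrite eq_sym GRing.oner_eq0.
Qed.
End Friendship.

(* Orthogonal sets as sequences of pairwise orthogonal points *)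
From mathcomp Require Import boolp classical_sets functions cardinality.

Local Open Scope classical_set_scope.
Local Open Scope card_scope.

Lemma card_eq_enum (T : Type) (A : set T) n : A #= `I_n ->
  exists2 g : 'I_n -> T, injective g & forall x, A x <-> exists i, g i = x.
Proof.
move=> /card_set_bijP[f [fI f_inj f_surj]].
have /choice[g gP] (i : 'I_n) : exists x, A x /\ f x = i.
  by have [x Ax fx] := f_surj i (ltn_ord i); exists x.
exists g => [i j gij|x].
  by apply: val_inj; rewrite /= -(gP i).2 -(gP j).2 gij.
split=> [Ax|[i <-]]; last by case: (gP i).
exists (Ordinal (fI x Ax)); case: (gP (Ordinal (fI x Ax))) => Ag fg.
by apply: f_inj; rewrite ?inE.
Qed.

Definition perpb (X : orthogonality_space) : rel X := fun x y => `[< x _|_ y >].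
(* [/=] would otherwise unfold [asbool] to a [match] on [pselect]. *)
Arguments perpb {X} x y : simpl never.

Section Basics.
Variable X : orthogonality_space.

Lemma perp_neq (x y : X) : x _|_ y -> x <> y.
Proof. by move=> xy E; move: xy; rewrite E; apply: perp_irrefl. Qed.

Lemma orthocomplement2 (x y z : X) :
  orthocomplement [set x; y] z = (z _|_ x /\ z _|_ y).
Proof.
apply: propext; split=> [H|[zx zy] a [->|->] //].
by split; apply: H; [left|right].
Qed.

Lemma pairwise_perp_size m (s : seq X) :
  has_rank X m -> pairwise perpb s -> size s <= m.
Proof.
move=> [bound _]; case: s => // x0 s0; set s := x0 :: s0 => s_perp.
have nth_perp i j : i < size s -> j < size s -> i <> j ->
    nth x0 s i _|_ nth x0 s j.
  move=> si sj /eqP; rewrite neq_ltn => /orP[] ij.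
    by apply/asboolP; move/(pairwiseP x0): s_perp; apply.
  by apply/perp_sym/asboolP; move/(pairwiseP x0): s_perp; apply.
have nth_card : nth x0 s @` `I_(size s) #= `I_(size s).
  apply: inj_card_eq => i j; rewrite !inE => si sj Eij.
  by apply/eqP/negPn/negP => /eqP /(nth_perp _ _ si sj)/perp_neq.
rewrite -card_le_II -(card_le_eql nth_card); apply: bound.
move=> _ _ [i si <-] [j sj <-] nij; apply: nth_perp => // ij.
by apply: nij; rewrite ij.
Qed.

(** Otherwise [m] would bound all orthogonal sets, and [m.+1] would not be the least bound. *)
Lemma has_rank_pairwise_perp m :
  has_rank X m.+1 -> exists2 s : seq X, pairwise perpb s & size s = m.+1.
Proof.
move=> Xrank; have [bound least] := Xrank; apply: contrapT => none.
suff : m.+1 <= m by rewrite ltnn.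
apply: least => A Aorth.
have [k Ak] : finite_set A by apply/finite_set_leP; exists m.+1; apply: bound.
rewrite (card_le_eql Ak) card_le_II leqNgt; apply/negP => mk.
have [g g_inj gA] := card_eq_enum _ _ _ Ak.
have g_perp : pairwise perpb (map g (enum 'I_k)).
  rewrite pairwise_map; have := enum_uniq 'I_k; rewrite uniq_pairwise.
  apply: sub_pairwise => i j /= ij; apply/asboolP/Aorth.
  - by apply/gA; exists i.
  - by apply/gA; exists j.
  - by move/g_inj; apply/eqP.
apply: none; exists (map g (enum 'I_k)) => //.
have := pairwise_perp_size _ _ Xrank g_perp.
by rewrite size_map size_enum_ord => km; apply/eqP; rewrite eqn_leq km mk.
Qed.

End Basics.
Arguments perp_neq {X x y} _ _.
Arguments orthocomplement2 {X x y z}.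
Arguments pairwise_perp_size {X m s} _ _.

(** * Consequences of linearity *)

Section Linear.
Variable X : orthogonality_space.
Hypothesis Xlin : linear_orthogonality X.

(** Of [f] and the third point [g], one is orthogonal to [e] and serves as [h]. *)
Lemma linear_perp (e f : X) : e <> f ->
  exists2 h, h _|_ e & forall x, x _|_ e -> (x _|_ f <-> x _|_ h).
Proof.
move=> /Xlin[g [_ _ Eg [[fe _]|[_ ge]]]].
  by exists f.
exists g => // x xe.
by have := congr1 (@^~ x) Eg; rewrite !orthocomplement2 => /propeqP; tauto.
Qed.

Lemma perp_total (a b : X) : a _|_ b -> forall x : X, exists y : X, x _|_ y.
Proof.
move=> ab x; have [->|xa] := pselect (x = a); first by exists b.
by have [h /perp_sym] := linear_perp _ _ xa; exists h.
Qed.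

(** * Rank two: uniqueness of the orthogonal point *)

Section RankTwo.
Hypothesis no_triple : forall s : seq X, pairwise perpb s -> size s <= 2.

(** If [y] and [z] differ, replacing [z] by some [h] orthogonal to [y] yields an orthogonal triple
    [x, y, h]. *)
Lemma perp_unique (x y z : X) : x _|_ y -> x _|_ z -> y = z.
Proof.
move=> xy xz; apply: contrapT => /linear_perp[h hy /(_ x xy)[/(_ xz) xh _]].
suff : pairwise perpb [:: x; y; h] by move/no_triple.
rewrite /= !andbT -andbA.
by apply/and3P; split; apply/asboolP => //; apply: perp_sym.
Qed.

End RankTwo.

(** * Rank three: the orthogonality graph is a friendship graph *)

Section RankThree.
Hypothesis no_quadruple : forall s : seq X, pairwise perpb s -> size s <= 3.
Variables a b c : X.
Hypotheses (ab : a _|_ b) (ac : a _|_ c) (bc : b _|_ c).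

(** Replace [y] by some [h] orthogonal to [x] and, if [z] and [t] differ, [t] by some [k] orthogonal
    to [z]. Then [k, z, x, h] are four mutually orthogonal points. *)
Lemma common_perp_unique (x y z t : X) : x <> y ->
  z _|_ x -> z _|_ y -> t _|_ x -> t _|_ y -> z = t.
Proof.
move=> /linear_perp[h hx hP] zx /hP-/(_ zx) zh tx /hP-/(_ tx) th.
apply: contrapT => /linear_perp[k kz kP].
have kx : k _|_ x := perp_sym ((kP x (perp_sym zx)).1 (perp_sym tx)).
have kh : k _|_ h := perp_sym ((kP h (perp_sym zh)).1 (perp_sym th)).
suff : pairwise perpb [:: k; z; x; h] by move/no_quadruple.
rewrite /= !andbT; apply/andP; split; first by
  apply/and3P; split; apply/asboolP.
apply/andP; split; last by apply/asboolP/perp_sym.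
by apply/andP; split; apply/asboolP.
Qed.

(** If [z] differs from [y], linearity replaces it by some [k] orthogonal to [y] and still to [x],
    against maximality. *)
Lemma maximal_pair_perp (x y z : X) : x _|_ y ->
  (forall t, t _|_ x -> ~ t _|_ y) -> x _|_ z -> z = y.
Proof.
move=> xy xy_max xz; apply: contrapT => zy.
have [k ky /(_ x xy)[/(_ xz)/perp_sym kx _]] :=
  linear_perp y z (fun E => zy (esym E)).
exact: xy_max kx ky.
Qed.

(* If [{x, y}] were a maximal orthogonal pair then, by linearity, every point
   would lie in a maximal orthogonal pair and so have a single orthogonal
   point. *)
Lemma perp_pair_extends (x y : X) : x _|_ y -> exists z, z _|_ x /\ z _|_ y.
Proof.
move=> xy; apply: contrapT => none.
have xy_max t : t _|_ x -> ~ t _|_ y by move=> tx ty; apply: none; exists t.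
have x_only z : x _|_ z -> z = y by apply: maximal_pair_perp.
have y_only z : y _|_ z -> z = x.
  by apply: maximal_pair_perp => [|t ty tx]; [apply: perp_sym|apply: xy_max ty].
suff [h hP] : exists h, forall z, a _|_ z -> z = h.
  by apply: (perp_neq bc); rewrite (hP b ab) (hP c ac).
have [->|nax] := pselect (a = x); first by exists y.
have [h ha hP] := linear_perp _ _ nax.
(* The pair [a, h] is maximal: a [t] orthogonal to both is orthogonal to [x], so it is [y], which
   forces [a = x]. *)
exists h => z; apply: maximal_pair_perp => [|t ta th]; first exact: perp_sym.
have tx : t _|_ x by apply/hP.
by apply: nax; apply: y_only; rewrite -(x_only t) //; apply: perp_sym.
Qed.

Lemma common_perp_exists (x y : X) : x <> y -> exists z, z _|_ x /\ z _|_ y.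
Proof.
move=> /linear_perp[h hx hP]; have [z [zh zx]] := perp_pair_extends _ _ hx.
by exists z; split => //; apply/hP.
Qed.

Lemma rank_three_infinite : infinite_set [set: X].
Proof.
move=> -[n /card_eq_enum[g g_inj g_surj]].
have [i0 _] : exists i, g i = a by apply/g_surj.
suff n0 : n = 0 by move: i0; rewrite n0; case.
apply: (@hubless_friendship_empty n (fun i j => perpb (g i) (g j)))
  => [i j|i|i j ij|i].
- by apply/asboolP/asboolP; apply: perp_sym.
- by apply/asboolP; apply: perp_irrefl.
- have gij : g i <> g j by move/g_inj; apply/eqP.
  have [z [zi zj]] := common_perp_exists _ _ gij.
  have [k gk] : exists k, g k = z by apply/g_surj.
  apply/eqP/cards1P; exists k; apply/setP => l; rewrite !inE.
  apply/andP/eqP => [[/asboolP il /asboolP jl]|->].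
    apply: g_inj; rewrite gk.
    by apply: (common_perp_unique _ _ _ _ gij) => //; apply: perp_sym.
  by rewrite gk; split; apply/asboolP; apply: perp_sym.
(* No hub: for [y] orthogonal to [g i], the third point of linearity is not orthogonal to [g i]. *)
- have [y iy] := perp_total _ _ ab (g i).
  have [z [zi _ _ [[_ iz]|[yi _]]]] := Xlin _ _ (perp_neq iy); last first.
    by case: yi; apply: perp_sym.
  have [k gk] : exists k, g k = z by apply/g_surj.
  exists k; apply/andP; split.
    by apply/eqP => ki; apply: zi; rewrite -gk ki.
  by apply/asboolP; rewrite gk => /perp_sym.
Qed.

End RankThree.

(** * The subspace of points orthogonal to a given point *)

Section Polar.
Variables e f : X.
Hypothesis fe : f _|_ e.

Definition polar : orthogonality_space :=
  @OrthogonalitySpace {x : X | x _|_ e} (fun x y => sval x _|_ sval y)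
    (ex_intro _ (exist _ f fe) I) (fun x y => @perp_sym X _ _)
    (fun x => @perp_irrefl X _).

Lemma polar_val_inj : injective (sval : polar -> X).
Proof.
by move=> x y; apply: eq_sig_hprop => u p q; apply: Prop_irrelevance.
Qed.

Lemma polar_linear : linear_orthogonality polar.
Proof.
move=> x y xy; have vxy : sval x <> sval y by move/polar_val_inj.
have [g [gx gy Eg xg]] := Xlin _ _ vxy.
have EgP z : (z _|_ sval x /\ z _|_ sval y) = (z _|_ sval x /\ z _|_ g).
  by rewrite -!orthocomplement2 Eg.
(* [e] is orthogonal to both points, hence to [g], so [g] lies in the subspace. *)
have ge : g _|_ e.
  have [] : e _|_ sval x /\ e _|_ g.
    rewrite -EgP.
    by split; [apply: perp_sym (svalP x) | apply: perp_sym (svalP y)].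
  by move=> _ /perp_sym.
exists (exist _ g ge); split=> //.
- by move=> E; apply: gx; rewrite -E.
- by move=> E; apply: gy; rewrite -E.
- by apply/predeqP => z; rewrite !orthocomplement2 EgP.
Qed.
End Polar.
End Linear.

Lemma polar_lift (X : orthogonality_space) (e f : X) (fe : f _|_ e)
    (s : seq X) :
  all (perpb e) s -> exists t : seq (polar _ _ _ fe), map sval t = s.
Proof.
elim: s => [_|x s IHs /= /andP[/asboolP/perp_sym xe /IHs[t <-]]].
  by exists [::].
by exists (exist _ x xe :: t).
Qed.

(** Induction on [n]: passing to the points orthogonal to the first member [e] of a longest
    orthogonal sequence lowers the maximal length by one, since [e] can be put back in front. *)
Lemma linear_infinite n (X : orthogonality_space) :
  linear_orthogonality X ->
  (forall s : seq X, pairwise perpb s -> size s <= n.+3) ->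
  (exists2 s : seq X, pairwise perpb s & size s = n.+3) ->
  infinite_set [set: X].
Proof.
elim: n X => [|n IHn] X Xlin s_max [[|e [|f s]] //= s_perp s_size].
  case: s s_perp s_size => [|c [|//]] //= + _; rewrite !andbT.
  move=> /andP[/andP[/asboolP ef /asboolP ec] /asboolP fc].
  exact: rank_three_infinite Xlin s_max _ _ _ ef ec fc.
case/andP: s_perp => es fs_perp.
have fe : f _|_ e by case/andP: es => /asboolP/perp_sym.
have [t tE] := polar_lift _ _ _ fe (f :: s) es.
have perp_val : pairwise perpb t.
  move: fs_perp; rewrite -[_ && _]/(pairwise perpb (f :: s)).
  by rewrite -tE pairwise_map.
move=> Xfin; apply: (IHn (polar X e f fe) (polar_linear _ Xlin _ _ _)).
- move=> u u_perp; have := s_max (e :: map sval u).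
  rewrite /= size_map pairwise_map u_perp andbT; apply.
  by rewrite all_map; elim: u {u_perp} => //= x u ->; rewrite andbT;
    apply/asboolP/perp_sym/(svalP x).
- exists t => //; have := congr1 size tE; rewrite size_map /= => ->.
  by case: s_size => ->.
- rewrite (_ : [set: polar X e f fe] = sval @^-1` [set: X]) //.
  by apply: finite_preimage => // x y _ _; apply: polar_val_inj.
Qed.

(** * Parity in rank two and infinity in higher rank *)

Theorem theorem35 (X : orthogonality_space) (m : nat)
    (Xlin : linear_orthogonality X) (Xrank : has_rank X m) :
  (m = 2%N ->
     (exists n : nat, ~~ odd n /\ [set: X] #= `I_n) \/
     infinite_set [set: X]) /\
  ((3 <= m)%N -> infinite_set [set: X]).
Proof.
split=> [m2|]; last first.
  case: m Xrank => [|[|[|m]]] // Xrank _.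
  apply: (linear_infinite m) => //; last exact: has_rank_pairwise_perp.
  by move=> s; apply: pairwise_perp_size.
rewrite {m}m2 in Xrank.
have [[n Xn]|] := pselect (finite_set [set: X]); last by right.
left; exists n; split=> //.
have [g g_inj g_surj] := card_eq_enum _ _ _ Xn.
have [[|a [|b [|]]] //=] := has_rank_pairwise_perp _ _ Xrank.
rewrite !andbT => /asboolP ab _.
(* [s] sends a point to its only orthogonal partner; symmetry makes it an involution, and
   irreflexivity excludes fixed points. *)
have /choice[s sP] (i : 'I_n) : exists j, g i _|_ g j.
  have [y iy] := perp_total _ Xlin _ _ ab (g i).
  by have [j gj] := (g_surj y).1 I; exists j; rewrite gj.
rewrite -(card_ord n); apply: (@involution_card_even _ s) => i.
  apply: g_inj; apply: (perp_unique _ Xlin _ (g (s i))) => [t||]; last 2 first.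
  - exact: sP.
  - exact: perp_sym (sP i).
  exact: pairwise_perp_size.
by apply/eqP => E; have := sP i; rewrite E; apply: perp_irrefl.
Qed.
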